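(* Assume that $\mathrm{MA(countable)}$ holds. Then there exists a $\mathrm{P}$-point $\mathcal{U}\subseteq 2^\omega$ that is countable dense homogeneous.
   Context: Every subset of $\omega$ is identified with its characteristic function, so an ultrafilter on $\omega$ is regarded as a subset of the Cantor set $2^\omega$ and carries the subspace topology. For $x,y\subseteq\omega$, $x\subseteq^\ast y$ means that $x\setminus y$ is finite; a pseudointersection of $\mathcal{C}\subseteq\mathcal{P}(\omega)$ is a set $x\subseteq\omega$ such that $x\subseteq^\ast y$ for all $y\in\mathcal{C}$. A $\mathrm{P}$-point is a non-principal ultrafilter $\mathcal{U}$ on $\omega$ such that every countable $\mathcal{C}\subseteq\mathcal{U}$ has a pseudointersection in $\mathcal{U}$. A (separable metrizable) space $X$ is countable dense homogeneous if for every pair $(D,E)$ of countable dense subsets of $X$ there exists a homeomorphism $f:X\to X$ such that $f[D]=E$. $\mathrm{MA(countable)}$ (Martin's Axiom for countable posets) is the statement: for every non-empty countable partially ordered set $\mathbb{P}$ and every collection $\mathcal{D}$ of dense subsets of $\mathbb{P}$ with $|\mathcal{D}|<\mathfrak{c}=2^{\aleph_0}$, there is a filter $G\subseteq\mathbb{P}$ that meets every element of $\mathcal{D}$. *)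

(* Defs.v *)
From HB Require Import structures.
From mathcomp Require Import all_boot all_order.
From mathcomp Require Import boolp classical_sets functions cardinality filter.
From mathcomp Require Import topology cantor.

Set Implicit Arguments.
Unset Strict Implicit.
Unset Printing Implicit Defensive.

Import Order.TTheory.

Local Open Scope classical_set_scope.

Definition card_lt T U (A : set T) (B : set U) : Prop :=
  (A #<= B)%card /\ ~ (A #= B)%card.

Section Posets.
Context {d : Order.disp_t} {P : porderType d}.

(* Forcing convention: smaller conditions are stronger, so dense sets are
   downward cofinal and filters are upward closed and downward directed. *)
Definition poset_dense (D : set P) : Prop :=
  forall p, exists2 q, D q & (q <= p)%O.

Definition poset_filter (G : set P) : Prop :=
  [/\ G !=set0,
      forall p q, G p -> (p <= q)%O -> G q
    & forall p q, G p -> G q -> exists r, [/\ G r, (r <= p)%O & (r <= q)%O]].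

End Posets.

(* The [choiceType] structure carried by a [porderType] is no restriction:
   classically every type has one. *)
Definition MA_countable : Prop :=
  forall (d : Order.disp_t) (P : porderType d) (DD : set (set P)),
    [set: P] !=set0 -> countable [set: P] ->
    (forall D, DD D -> poset_dense D) ->
    card_lt DD [set: nat -> bool] ->
    exists2 G : set P, poset_filter G & forall D, DD D -> G `&` D !=set0.

Definition almost_subset (x y : set nat) : Prop := finite_set (x `\` y).

Definition pseudointersection (C : set (set nat)) (x : set nat) : Prop :=
  forall y, C y -> almost_subset x y.

Definition P_point (U : set_system nat) : Prop :=
  [/\ UltraFilter U,
      forall n, U <> principal_filter n
    & forall C : set (set nat), countable C -> C `<=` U ->
        exists2 x, U x & pseudointersection C x].

Definition char_fun (A : set nat) : cantor_space := fun n => n \in A.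

Definition homeomorphism (X Y : topologicalType) (f : X -> Y) : Prop :=
  continuous f /\
  exists g : Y -> X, [/\ cancel f g, cancel g f & continuous g].

(* Separability and metrizability of [X] are not part of the definition; they
   hold for every subspace of the Cantor space. *)
Definition countable_dense_homogeneous (X : topologicalType) : Prop :=
  forall D E : set X,
    countable D -> dense D -> countable E -> dense E ->
    exists2 f : X -> X, homeomorphism f & f @` D = E.

(* Main.v *)
Require Import Defs.
From HB Require Import structures.
From mathcomp Require Import all_boot all_order.
From mathcomp Require Import boolp wochoice classical_sets functions.
From mathcomp Require Import cardinality filter.
From mathcomp Require Import topology cantor.

Set Implicit Arguments.
Unset Strict Implicit.
Unset Printing Implicit Defensive.

Local Open Scope classical_set_scope.

(** The proof has two independent halves: Martin's Axiom for countable posets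
    yields a P-point, and every P-point is countable dense homogeneous.

    A P-point is obtained by a transfinite recursion of length continuum.  Each
    [x : nat -> bool] codes a sequence of sets; at stage [x], if that sequence
    is compatible with the sets chosen so far, one adds a pseudointersection of
    it that still meets all finite intersections of earlier sets
    ([MA_pseudointersection], by forcing with finite sequences of bounds).  The
    axiom applies as long as there are fewer than continuum many such finite
    intersections, so the recursion needs a well-order of the continuum all of
    whose initial segments carry fewer than continuum many finite words
    ([small_strict_well_order]).  Any ultrafilter extending the resulting
    family is a P-point: a sequence of its members is necessarily compatible
    at the stage that codes it.

    For the second half (a theorem of Hernandez-Gutierrez and Hrusak for
    non-meager P-filters), let [D] and [E] be countable dense subsets of a
    P-point [U].  A pseudointersection of [D] and [E] in [U] can be thinned
    out, inside [U], to a set [x] such that above every finite binary word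
    both [D] and [E] have a point containing the remainder of [x]
    ([P_point_rich]).  A back-and-forth argument then pairs [D] with [E] so
    that paired points agree on [x] and the pairing preserves the first level
    at which two points differ ([rich_homogeneous]).  Such a pairing is induced
    by an automorphism of the binary tree, given by the nodes at which it
    flips the next bit; this automorphism is an isometry of the Cantor space
    which changes no coordinate in [x].  Since [x] belongs to [U], it maps
    [U] onto itself. *)

(** * Finite words over a set *)

Section Words.
Variable T : eqType.
Implicit Type A : set T.

(** The letters from [nat] leave room for coding: separators and a name for one
    extra element of [T] are available even when [A] is finite or empty. *)
Definition words A : set (seq (nat + T)) :=
  [set l | forall x, inr x \in l -> A x].

Lemma words_sub A A' : A `<=` A' -> words A `<=` words A'.
Proof. by move=> AA' l lA x /lA/AA'. Qed.

(** The letter [inl 0] is freed for [y] by shifting the other numerals. *)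
Lemma card_words_add A y : (words (A `|` [set y]) #<= words A)%card.
Proof.
pose dec (i : nat + T) := match i with
  | inl 0 => inr y | inl n.+1 => inl n | inr x => inr x end.
pose enc (i : nat + T) := match i with
  | inl n => inl n.+1 | inr x => if x == y then inl 0 else inr x end.
have encK : cancel enc dec by case=> [n|x] //=; case: eqP => // ->.
apply: card_le_trans (card_image_le (map dec) (words A)).
apply: subset_card_le => l lAy; exists (map enc l); last exact: mapK.
move=> x /mapP[[n|z] //= zl]; case: eqP => // zy [->].
by case: (lAy _ zl).
Qed.

Definition push (i : nat + T) (L : seq (nat + seq (nat + T))) :=
  if L is inr w :: L' then inr (i :: w) :: L' else L.

(** A word codes a list of numerals and words: positive even numerals stand
    for the numerals of the list, odd numerals and elements of [T] for letters
    of an inner word, and [inl 0] closes an inner word.  Reading from the right,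
    every letter is thus pushed on the inner word that has just been opened. *)
Fixpoint parse (l : seq (nat + T)) : seq (nat + seq (nat + T)) :=
  match l with
  | [::] => [::]
  | inl 0 :: l' => inr [::] :: parse l'
  | inl n.+1 :: l' =>
      if odd n then inl n./2 :: parse l' else push (inl n./2) (parse l')
  | inr x :: l' => push (inr x) (parse l')
  end.

Definition spell_letter (i : nat + T) : nat + T :=
  if i is inl n then inl n.*2.+1 else i.

Definition spell (i : nat + seq (nat + T)) : seq (nat + T) :=
  match i with
  | inl n => [:: inl n.*2.+2]
  | inr w => rcons (map spell_letter w) (inl 0)
  end.

Lemma parse_spell i l : parse (spell i ++ l) = i :: parse l.
Proof.
case: i => [n|w] /=; first by rewrite odd_double /= uphalf_double.
elim: w => [//|[n|x] w IHw] /=; rewrite IHw//=.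
by rewrite odd_double /= doubleK.
Qed.

Lemma spellK : cancel (fun L => flatten (map spell L)) parse.
Proof. by elim=> [//|i L IHL] /=; rewrite parse_spell IHL. Qed.

End Words.

Lemma card_words_words (T : eqType) (A : set T) :
  (words (words A) #<= words A)%card.
Proof.
apply: card_le_trans (card_image_le (@parse T) (words A)).
apply: subset_card_le => L LA; exists (flatten (map (@spell T) L)); last exact: spellK.
move=> x /flatten_mapP[[n|w] iL /=]; first by rewrite inE.
rewrite mem_rcons inE /= => /mapP[[n|z] //= zw [->]].
exact: LA _ iL _ zw.
Qed.

Lemma card_le_inj T T' (f : T -> T') (A : set T) (B : set T') :
  injective f -> (forall x, A x -> B (f x)) -> (A #<= B)%card.
Proof.
move=> finj AB; have /card_eqPle[_ cA] := inj_card_eq (in2W finj : {in A &, _}).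
apply: card_le_trans cA (subset_card_le _).
by move=> _ [x Ax <-]; exact: AB.
Qed.

Lemma card_words_inj (T T' : eqType) (f : T -> T') (A : set T) (B : set T') :
  injective f -> (forall x, A x -> B (f x)) -> (words A #<= words B)%card.
Proof.
move=> finj AB.
pose g (i : nat + T) : nat + T' :=
  match i with inl n => inl n | inr x => inr (f x) end.
have ginj : injective g.
  by move=> [n|x] [m|y] //= []; [move=> -> | move=> /finj ->].
apply: card_le_inj (inj_map ginj) _ => l lA y /mapP[[n|x] //= xl [->]].
exact/AB/lA.
Qed.

(** The smallness needed to meet one dense set for each finite intersection of
    sets indexed by [A].  For uncountable [T] and infinite [A] it amounts to
    [A] having smaller cardinality than [T]. *)
Definition small (T : eqType) (A : set T) := ~ ([set: T] #<= words A)%card.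

Lemma small_sub (T : eqType) (A B : set T) : A `<=` B -> small B -> small A.
Proof.
move=> AB sB cA; apply: sB; apply: card_le_trans cA _.
exact: subset_card_le (words_sub AB).
Qed.

Lemma small_add (T : eqType) (A : set T) y : small A -> small (A `|` [set y]).
Proof. by move=> sA cA; apply: sA; apply: card_le_trans cA (card_words_add _ _). Qed.

(** Initial segments of the final well-order are coded by words over initial
    segments of another one; words over words are again words. *)
Lemma small_inj (T : eqType) (f : T -> seq (nat + T)) (A B : set T) :
  injective f -> (forall x, A x -> words B (f x)) -> small B -> small A.
Proof.
move=> finj AB sB cA; apply: sB; apply: card_le_trans cA _.
exact: card_le_trans (card_words_inj finj AB) (card_words_words _).
Qed.

(** * A well-order with small initial segments *)

Definition strict_well_order (T : Type) (lt : T -> T -> Prop) :=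
  [/\ well_founded lt, forall y x z, lt x y -> lt y z -> lt x z &
      forall x y, [\/ lt x y, x = y | lt y x]].

Lemma strict_well_order_exists (T : eqType) :
  exists lt : T -> T -> Prop, strict_well_order lt.
Proof.
have [R Rwo] := well_ordering_principle T.
have Rch : wo_chain R predT by exact: withinW.
have Rtot x y : R x y || R y x by exact: (wo_chainW Rch).
have Ranti x y : R x y -> R y x -> x = y.
  by move=> xy yx; apply: (wo_chain_antisymmetric Rch) => //; rewrite xy.
have least (P : T -> Prop) x : P x -> exists2 z, P z & forall y, P y -> R z y.
  move=> Px; have [|z [[/asboolP Pz zP] _]] := Rwo (fun y => `[< P y >]).
    by exists x; exact/asboolP.
  by exists z => // y Py; apply: zP; exact/asboolP.
exists (fun x y => R x y /\ x <> y); split.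
- move=> x; apply: contrapT => nAx.
  have [z nAz zmin] := least (fun x => ~ Acc _ x) x nAx.
  apply: nAz; constructor => y [yz neq]; apply: contrapT => /zmin zy.
  by apply: neq; exact: Ranti.
- move=> y x z [xy nxy] [yz nyz]; split; last first.
    by move=> xz; apply: nxy; apply: Ranti => //; rewrite xz.
  have [w wP wmin] := least (fun w => [\/ w = x, w = y | w = z]) x (Or31 _ _ erefl).
  have [wx wy] : R w x /\ R w y by split; apply: wmin; [exact: Or31 | exact: Or32].
  have : R w z by apply: wmin; exact: Or33.
  case: wP wx wy => -> // wx wy _.
    by rewrite (Ranti _ _ xy wx).
  by rewrite -(Ranti _ _ yz wy).
- move=> x y; have [->|/eqP xy] := eqVneq x y; first by constructor 2.
  have /orP[Rxy|Ryx] := Rtot x y; first by constructor 1.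
  by constructor 3; split=> // yx; exact: xy.
Qed.

(** In a finite word some letter from [T] is the largest one, unless there is
    none: here the order is total. *)
Lemma word_top (T : eqType) (lt : T -> T -> Prop) (l : seq (nat + T)) :
    strict_well_order lt ->
  words set0 l \/ exists2 m, inr m \in l & words ([set x | lt x m] `|` [set m]) l.
Proof.
move=> [_ ltt tri]; elim: l => [|i l IHl]; first by left.
have here z A : words A l -> (forall x, A x -> lt x z) ->
    words ([set x | lt x z] `|` [set z]) (inr z :: l).
  by move=> lA Az x; rewrite inE => /orP[/eqP[->]|/lA/Az]; [right | left].
have skip n A : words A l -> words A (inl n :: l).
  by move=> lA x; rewrite inE => /orP[/eqP //|]; exact: lA.
have {IHl}[l0|[m ml lm]] := IHl; case: i => [n|z].
- by left; exact: skip.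
- by right; exists z; [rewrite inE eqxx | exact: here l0 _].
- by right; exists m; [rewrite inE ml orbT | exact: skip].
- right; have [zm|zm|mz] := tri z m.
  + exists m; first by rewrite inE ml orbT.
    by move=> x; rewrite inE => /orP[/eqP[->]|]; [left | exact: lm].
  + exists m; first by rewrite inE ml orbT.
    by move=> x; rewrite inE => /orP[/eqP[->]|]; [right | exact: lm].
  + exists z; first by rewrite inE eqxx.
    by apply: here lm _ => x [xm|->]; [exact: ltt xm mz | ].
Qed.

(** Start from any well-order and let [W] consist of the points whose initial
    segment is small.  [W] is an initial segment that is not itself small, so
    [T] injects into the words over [W]; rank a point by the largest letter of
    its word.  Ordering [T] by rank first, and by the original order within a
    rank, makes each initial segment inject into the words over a small set. *)
Theorem small_strict_well_order (T : eqType) : ~ countable [set: T] ->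
  exists2 lt : T -> T -> Prop, strict_well_order lt &
    forall x, small [set y | lt y x].
Proof.
move=> uncT; have [lt lt_wo] := strict_well_order_exists T.
have [wf ltt tri] := lt_wo.
pose W := [set y | small [set z | lt z y]].
have Wlarge : ~ small W.
  have [WT|] := pselect (forall y, W y).
    apply; apply: (@card_le_inj _ _ (fun x => [:: inr x])); first by move=> x y [].
    move=> x _ y _; exact: WT.
  (* The initial segment of the least point outside [W] is included in [W]. *)
  move=> /existsNP[y0]; elim/(well_founded_ind wf): y0 => y IHy nWy sW.
  apply: nWy; apply: (small_sub _ sW) => z zy; apply: contrapT => nWz.
  exact: IHy zy nWz sW.
(* Without letters from [T] there are only countably many words. *)
have [w0 Ww0] : exists w, W w.
  apply: contrapT => /forallNP W0; apply: Wlarge => cW; apply: uncT.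
  apply: card_le_trans cW (card_le_trans _ (countableP [set: seq nat])).
  apply: card_le_trans (card_image_le (map inl) [set: seq nat]).
  apply: subset_card_le => l lW.
  exists (pmap (fun i : nat + T => if i is inl n then Some n else None) l) => //.
  elim: l lW => [//|[n|x] l IHl] lW /=; last first.
    by case: (W0 x); apply: lW; rewrite inE eqxx.
  by rewrite IHl// => x xl; apply: lW; rewrite inE xl orbT.
have [c cinj cW] : exists2 c : T -> seq (nat + T),
    injective c & forall x, words W (c x).
  have /card_leP[f] : ([set: T] #<= words W)%card by exact: contrapT.
  pose inT x : [set: T] := exist _ x (mem_set I).
  exists (fun x => val (f (inT x))) => [x y /val_inj fxy|x]; last exact: set_valP.
  by have /(congr1 val) : inT x = inT y by apply: 'inj_f fxy; rewrite inE.
have /choice[rk rkP] x :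
    exists r, W r /\ words ([set y | lt y r] `|` [set r]) (c x).
  have [c0|[m mc cm]] := word_top (c x) lt_wo.
    by exists w0; split=> //; exact: words_sub c0.
  by exists m; split=> //; exact: cW mc.
exists (fun x y => lt (rk x) (rk y) \/ rk x = rk y /\ lt x y).
  split.
  - move=> x; move: {2}(rk x) (erefl (rk x)) => r.
    elim/(well_founded_ind wf): r x => r IHr x.
    elim/(well_founded_ind wf): x => x IHx rx; constructor => y [yx|[yx ltyx]].
      by apply: (IHr (rk y)) => //; rewrite -rx.
    by apply: IHx => //; rewrite yx.
  - move=> y x z [xy|[xy ltxy]] [yz|[yz ltyz]].
    + by left; exact: ltt xy yz.
    + by left; rewrite -yz.
    + by left; rewrite xy.
    + by right; split; [rewrite xy | exact: ltt ltxy ltyz].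
  - move=> x y; have [xy|xy|yx] := tri (rk x) (rk y).
    + by constructor 1; left.
    + have [ltxy|->|ltyx] := tri x y.
      * by constructor 1; right.
      * by constructor 2.
      * by constructor 3; right.
    + by constructor 3; left.
move=> x; have [Wr _] := rkP x.
apply: (@small_inj _ c _ ([set y | lt y (rk x)] `|` [set rk x])).
- exact: cinj.
- move=> y yx; have [_] := rkP y; apply: words_sub => z [zy|->].
    by case: yx => [yx|[<- _]]; left => //; exact: ltt zy yx.
  by case: yx => [yx|[-> _]]; [left | right].
- exact: small_add.
Qed.

(** * Pseudointersections from generic bounds *)

(** A condition is a finite approximation [f 0, ..., f n] of a sequence of
    bounds, and the set to be built is the union of the [C n] cut at [f n],
    for [C] made decreasing.  The alias of [seq nat] carries the order by
    extension. *)
Definition bound_condition := seq nat.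

HB.instance Definition _ := Countable.on bound_condition.

Definition extends (p q : bound_condition) := prefix q p.

Lemma extends_refl : reflexive extends. Proof. exact: prefix_refl. Qed.

Lemma extends_anti : antisymmetric extends.
Proof.
move=> p q /andP[/prefixP[s ->]]; rewrite /extends prefixE size_cat.
by rewrite take_oversize ?leq_addr// => /eqP.
Qed.

Lemma extends_trans : transitive extends.
Proof. by move=> q p r qp rq; exact: prefix_trans rq qp. Qed.

Fact bound_condition_display : Order.disp_t. Proof. exact: Order.Disp tt tt. Qed.

HB.instance Definition _ := @Order.Le_isPOrder.Build bound_condition_display
  bound_condition extends extends_refl extends_anti extends_trans.

Lemma card_countable_powerset (T : countType) (DD : set (set T)) :
  (DD #<= [set: nat -> bool])%card.
Proof.
apply/pcard_leTP/injPex; exists (fun D n =>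
  if unpickle n is Some p then `[< D p >] else false).
move=> D D' _ _ DD'.
have DpE p : `[< D p >] = `[< D' p >].
  by have := congr1 (fun f => f (pickle p)) DD'; rewrite /= pickleK.
by apply/seteqP; split=> p /asboolP; [rewrite DpE | rewrite -DpE] => /asboolP.
Qed.

(** The generic sequence of bounds grows fast enough to catch a point of every
    member of [B]: any condition can be extended by a bound exceeding a common
    element of the given [b] and of the first terms of [C].  The set so built
    minus [C m] only involves the bounds of index below [m], so it is finite. *)
Lemma MA_pseudointersection (B : set (set nat)) (C : nat -> set nat) :
    MA_countable -> ~ ([set: nat -> bool] #<= B)%card ->
    (forall b n, B b -> exists2 k, b k & forall i, i <= n -> C i k) ->
  exists x, (forall n, almost_subset x (C n)) /\
    forall b, B b -> b `&` x !=set0.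
Proof.
move=> MA smallB BC.
pose caught (p : bound_condition) n k :=
  [/\ n < size p, k < nth 0 p n & forall i, i <= n -> C i k].
pose hit b : set bound_condition :=
  [set p | exists2 k, b k & exists n, caught p n k].
have [D [b Bb <-] p||G [_ Gup Gdir] Ghit] :=
  MA _ bound_condition (hit @` B)
    (ex_intro _ [::] I) (countableP _).
- have [k bk Ck] := BC b (size p) Bb.
  (* The new bound lies just above the element [k] to be caught. *)
  exists (rcons p k.+1); last exact: prefix_rcons.
  exists k => //; exists (size p).
  by rewrite /caught size_rcons ltnSn nth_rcons ltnn eqxx.
- split; first exact: card_countable_powerset.
  move=> /card_eqPle[_ cB]; apply: smallB.
  exact: card_le_trans cB (card_image_le _ _).
have coherent p q n : G p -> G q -> n < size p -> n < size q -> nth 0 p n = nth 0 q n.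
  move=> Gp Gq np nq; have [r [_ /prefixP[s sE] /prefixP[s' rE]]] := Gdir p q Gp Gq.
  have : nth 0 (p ++ s) n = nth 0 (q ++ s') n by rewrite -sE rE.
  by rewrite !nth_cat np nq.
exists [set k | exists p n, G p /\ caught p n k]; split=> [m|b Bb].
  have /choice[bd bdP] n : exists N, forall p, G p -> n < size p -> nth 0 p n <= N.
    have [[p [Gp np]]|nop] := pselect (exists p, G p /\ n < size p).
      by exists (nth 0 p n) => q Gq nq; rewrite (coherent q p).
    by exists 0 => p Gp np; case: nop; exists p.
  apply: sub_finite_set (finite_II (\sum_(n < m) bd n)).
  move=> k [[p [n [Gp [np knth Ck]]]] nCk] /=.
  have nm : n < m by rewrite ltnNge; apply/negP => /Ck.
  rewrite (bigD1 (Ordinal nm))//=; apply: leq_trans (leq_addr _ _).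
  exact: leq_trans knth (bdP n p Gp np).
have [p [Gp [k bk [n pnk]]]] := Ghit _ (ex_intro2 _ _ b Bb erefl).
by exists k; split=> //; exists p, n.
Qed.

(** * Existence of P-points *)

(** The value chosen at [x] may depend on all earlier values, which are handed
    over as a total function padded by a default value; [P] must ignore the
    padding. *)
Lemma well_founded_choice (T : Type) (B : pointedType) (lt : T -> T -> Prop)
    (P : T -> (T -> B) -> B -> Prop) :
    well_founded lt -> (forall x g, exists b, P x g b) ->
    (forall x g g' b, (forall y, lt y x -> g y = g' y) -> P x g b -> P x g' b) ->
  exists G, forall x, P x G (G x).
Proof.
move=> wf Pex Pext.
have /choice[F FP] (xg : T * (T -> B)) : exists b, P xg.1 xg.2 b by exact: Pex.
pose step x (rec : forall y, lt y x -> B) : B :=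
  F (x, fun y => if pselect (lt y x) is left yx then rec y yx else point).
exists (Fix wf (fun=> B) step) => x; rewrite Fix_eq.
  by apply: Pext (FP (x, _)) => y yx /=; case: pselect.
move=> y f g fg; congr (F (_, _)); apply/funext => z.
by case: pselect.
Qed.

Section Generated.
Variables (T : eqType) (G : T -> set nat).

(** Besides the sets [G x], the alphabet names the final segments of [nat], so
    that a nonempty [meet] for all words means that finite intersections of the
    [G x] are infinite. *)
Definition letter (i : nat + T) : set nat :=
  match i with inl n => [set k | n <= k] | inr x => G x end.

Definition meet (l : seq (nat + T)) : set nat :=
  [set k | forall i, i \in l -> letter i k].

Definition centered (A : set T) := forall l, words A l -> meet l !=set0.

(** Centeredness is preserved at limits because it concerns finitely many sets
    at a time, and these have a last one. *)
Lemma centered_union (lt : T -> T -> Prop) :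
    strict_well_order lt ->
    (forall x, centered [set y | lt y x] ->
       centered ([set y | lt y x] `|` [set x])) ->
  centered setT.
Proof.
move=> lt_wo step; have [wf _ _] := lt_wo.
have union A : (forall x, A x -> centered [set y | lt y x]) -> centered A.
  move=> Ac l lA; have [l0|[m ml lm]] := word_top l lt_wo; last first.
    by apply: step lm; apply: Ac; exact: lA.
  pose height (i : nat + T) := if i is inl n then n else 0.
  exists (\max_(i <- l) height i) => -[n|x] il; last by have := l0 _ il.
  exact: (@leq_bigmax_seq _ _ xpredT height _ il).
apply: (union setT) => x _; elim/(well_founded_ind wf): x => x IHx.
exact: union.
Qed.

Definition generated : set_system nat :=
  [set S | exists l, meet l `<=` S].

Lemma generated_proper : centered setT -> ProperFilter generated.
Proof.
move=> cG; split=> [[l lS]|].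
  by have [|k /lS] := cG l; first by [].
split=> [|P Q [l lP] [l' lQ]|P Q PQ [l lP]].
- by exists [::].
- exists (l ++ l') => k kl.
  by split; [apply: lP | apply: lQ] => i il; apply: kl; rewrite mem_cat il ?orbT.
- by exists l; exact: subset_trans PQ.
Qed.

End Generated.

Lemma eq_meet (T : eqType) (G G' : T -> set nat) (A : set T) l :
  (forall x, A x -> G x = G' x) -> words A l -> meet G l = meet G' l.
Proof.
move=> GG' lA; apply/seteqP; split=> k kl [n|x] il; have := kl _ il => //=.
  by rewrite (GG' _ (lA _ il)).
by rewrite (GG' _ (lA _ il)).
Qed.

Definition decode (x : nat -> bool) (n : nat) : set nat :=
  [set k | x (pickle (n, k))].

Lemma decode_surj (C : nat -> set nat) : exists x, decode x = C.
Proof.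
exists (fun m => if unpickle m is Some (n, k) then `[< C n k >] else false).
apply/funext => n; apply/seteqP; split=> k; rewrite /decode /= pickleK.
  by move/asboolP.
by move=> ?; exact/asboolP.
Qed.

Lemma uncountable_cantor : ~ countable [set: nat -> bool].
Proof.
move=> /pfcard_geP[T0|[f]].
  by have : [set: nat -> bool] point by []; rewrite T0.
have [n _ fn] := 'surj_f (I : [set: nat -> bool] (fun n => ~~ f n n)).
by have := congr1 (@^~ n) fn; rewrite /=; case: (f n n).
Qed.

(** The stage [x] acts only if the sequence coded by [x] is compatible with the
    sets already chosen.  This makes bookkeeping unnecessary: it need not be
    known in advance which sequences lie in the final ultrafilter, since those
    which do are compatible at their own stage. *)
Theorem P_point_exists : MA_countable -> exists U, P_point U.
Proof.
move=> MA.
have [lt lt_wo lt_small] := small_strict_well_order uncountable_cantor.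
pose below x : set (nat -> bool) := [set y | lt y x].
pose compatible x (G : (nat -> bool) -> set nat) := forall l n, words (below x) l ->
  exists2 k, meet G l k & forall i, i <= n -> decode x i k.
pose good x (G : (nat -> bool) -> set nat) s :=
  (compatible x G -> (forall n, almost_subset s (decode x n)) /\
     forall l, words (below x) l -> meet G l `&` s !=set0) /\
  (~ compatible x G -> s = setT).
have wf : well_founded lt by case: lt_wo.
have [x G|x G G' s GG'|G Ggood] := @well_founded_choice _ (set nat) _ good wf.
- have [cG|ncG] := pselect (compatible x G); last by exists setT; split.
  have [|_ n [l lx <-]|s [sC sG]] :=
    @MA_pseudointersection (meet G @` words (below x)) (decode x) MA.
  + by move=> cB; apply: (lt_small x); exact: card_le_trans cB (card_image_le _ _).
  + exact: cG.
  + by exists s; split=> // _; split=> // l lx; apply: sG; exists l.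
- have E l : words (below x) l -> meet G l = meet G' l.
    by apply: eq_meet => y; exact: GG'.
  have cE : compatible x G' -> compatible x G by move=> c l n lx; rewrite E//; exact: c.
  have cE' : compatible x G -> compatible x G' by move=> c l n lx; rewrite -E//; exact: c.
  move=> [s1 s2]; split=> [/cE/s1[sC sG]|nc]; last by apply: s2 => /cE'.
  by split=> // l lx; rewrite -E//; exact: sG.
have cG : centered G setT.
  apply: (centered_union lt_wo) => x cx l lx.
  pose l' := [seq i <- l | i != inr x].
  have l'x : words (below x) l'.
    move=> y; rewrite mem_filter => /andP[yx /lx[//|xy]].
    by rewrite xy eqxx in yx.
  have [k [kl' Gxk]] : meet G l' `&` G x !=set0.
    have [good1 good2] := Ggood x.
    have [/good1[_ /(_ l' l'x)//]|/good2 ->] := pselect (compatible x G).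
    by rewrite setIT; exact: cx.
  exists k => i il; have [->//|ix] := eqVneq i (inr x).
  by apply: kl'; rewrite mem_filter ix.
have [U [UU GU]] := ultraFilterLemma (generated_proper cG).
have Umeet l : U (meet G l) by apply: GU; exists l.
exists U; split=> // [n Un|C cC CU].
  have := Umeet [:: inl n.+1]; rewrite Un principal_filterP.
  by move=> /(_ (inl n.+1)); rewrite inE eqxx => /(_ erefl) /=; rewrite ltnn.
have [c cE cU] : exists2 c : nat -> set nat, C `<=` range c & forall n, U (c n).
  have /pfcard_geP[C0|[f]] := cC.
    by exists (fun=> setT) => [|n]; [rewrite C0 | exact: filterT].
  exists f => [s /'surj_f[n _ <-]|n]; first by exists n.
  exact/CU/'funS_f.
have [x xc] := decode_surj c.
have Gxc : forall n, almost_subset (G x) (c n).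
  rewrite -xc; apply: ((Ggood x).1 _).1 => l n _.
  have Un : U [set k | forall i, i <= n -> decode x i k].
    elim: n => [|n IHn].
      by apply: filterS (cU 0) => k k0 i; rewrite leqn0 xc => /eqP->.
    apply: filterS (filterI IHn (cU n.+1)) => k [kn kn1] i.
    by rewrite leq_eqVlt xc => /orP[/eqP->//|]; rewrite -xc; exact: kn.
  by have [k [kl kn]] := filter_ex (filterI (Umeet l) Un); exists k.
exists (G x); last by move=> _ /cE[n _ <-].
apply: filterS (Umeet [:: inr x]) => k /(_ (inr x)); rewrite inE eqxx; exact.
Qed.

(** * Automorphisms of the binary tree *)

(** The automorphisms of the infinite binary tree are exactly the maps
    [twist a]: the node [s] tells by [a s] whether the two edges leaving it
    are exchanged. *)
Definition twist (a : seq bool -> bool) (z : nat -> bool) : nat -> bool :=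
  fun n => z n (+) a (mkseq z n).

(** The inverse must know its own output below level [n] in order to query [a],
    so that prefixes are computed first. *)
Fixpoint untwist_prefix (a : seq bool -> bool) (z : nat -> bool) n :=
  if n is m.+1 then
    rcons (untwist_prefix a z m) (z m (+) a (untwist_prefix a z m))
  else [::].

Definition untwist a z : nat -> bool :=
  fun n => z n (+) a (untwist_prefix a z n).

Lemma untwistE a z n : untwist a z n = z n (+) a (mkseq (untwist a z) n).
Proof.
rewrite {1}/untwist; congr (_ (+) a _).
by elim: n => //= n IHn; rewrite mkseqS -IHn.
Qed.

Lemma mkseqS_eq (T : Type) (z w : nat -> T) n :
  mkseq z n.+1 = mkseq w n.+1 <-> mkseq z n = mkseq w n /\ z n = w n.
Proof. by rewrite !mkseqS; split=> [/rcons_inj[-> ->]|[-> ->]]. Qed.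

Lemma mkseq_eqW (T : Type) (z w : nat -> T) m n : m <= n ->
  mkseq z n = mkseq w n -> mkseq z m = mkseq w m.
Proof.
move=> /subnK <-; elim: (n - m) => [//|k IHk].
by rewrite addSn => /mkseqS_eq[+ _].
Qed.

Lemma mkseq_eqP (T : Type) (z w : nat -> T) n :
  mkseq z n = mkseq w n <-> forall i, i < n -> z i = w i.
Proof.
split=> [zw i ltin|zw].
  by have /mkseqS_eq[] := mkseq_eqW ltin zw.
elim: n zw => [//|n IHn] zw; apply/mkseqS_eq; split; last exact: zw.
by apply: IHn => i ltin; apply/zw/ltnW.
Qed.

Lemma twistK a : cancel (twist a) (untwist a).
Proof.
move=> z; apply/funext=> n.
suff /mkseqS_eq[] : mkseq (untwist a (twist a z)) n.+1 = mkseq z n.+1 by [].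
elim: n.+1 => [//|k IHk]; apply/mkseqS_eq; split=> //.
by rewrite untwistE IHk /twist addbK.
Qed.

Lemma untwistK a : cancel (untwist a) (twist a).
Proof. by move=> z; apply/funext=> n; rewrite /twist untwistE addbK. Qed.

Lemma twist_isometry a z w n :
  mkseq (twist a z) n = mkseq (twist a w) n <-> mkseq z n = mkseq w n.
Proof.
elim: n => [//|n IHn]; split=> /mkseqS_eq[].
  move=> /IHn zw; rewrite /twist zw => /addIb ?; exact/mkseqS_eq.
by move=> zw zwn; apply/mkseqS_eq; split; [exact/IHn | rewrite /twist zw zwn].
Qed.

Lemma untwist_isometry a z w n :
  mkseq (untwist a z) n = mkseq (untwist a w) n <-> mkseq z n = mkseq w n.
Proof. by rewrite -(twist_isometry a) !untwistK. Qed.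

(** A relation that may be contained in the graph of a tree automorphism fixing
    the coordinates in [x]. *)
Definition matching (x : set nat) (R : set ((nat -> bool) * (nat -> bool))) :=
  (forall p q n, R p -> R q ->
     mkseq p.1 n = mkseq q.1 n <-> mkseq p.2 n = mkseq q.2 n) /\
  (forall p n, R p -> x n -> p.1 n = p.2 n).

Definition portrait (R : set ((nat -> bool) * (nat -> bool))) (s : seq bool) :=
  `[< exists p, [/\ R p, mkseq p.1 (size s) = s & p.1 (size s) != p.2 (size s)] >].

(** If two points [p.1] and [q.1] run through the same node of level [n], so do
    their images; since the branchings match at level [n.+1], both pairs agree
    on whether the node exchanges its edges, so the portrait is unambiguous. *)
Lemma twist_portrait x R p : matching x R -> R p ->
  twist (portrait R) p.1 = p.2.
Proof.
move=> [iso _] Rp; apply/funext=> n; rewrite /twist /portrait size_mkseq.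
case: asboolP.
  move=> [q [Rq qp1 nq]].
  have qp2 : mkseq q.2 n = mkseq p.2 n by apply/(iso q p n Rq Rp).
  have := iso _ _ n.+1 Rq Rp; rewrite !mkseqS_eq => -[l r].
  move: nq l r; case: (q.1 n); case: (q.2 n); case: (p.1 n); case: (p.2 n) => // _ l r;
    by [have [] := l (conj qp1 erefl) | have [] := r (conj qp2 erefl)].
move=> /forallNP/(_ p)nRp; rewrite addbF; apply/eqP/negPn/negP => npn.
by case: nRp.
Qed.

Lemma portrait_fix x R s : matching x R -> x (size s) -> portrait R s = false.
Proof.
move=> [_ fx] xs; apply/negP => /asboolP[p [Rp _]].
by rewrite (fx _ _ Rp xs) eqxx.
Qed.

Lemma twist_fix a (x : set nat) z n :
  (forall s, x (size s) -> a s = false) -> x n -> twist a z n = z n.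
Proof. by move=> ax xn; rewrite /twist ax ?addbF// size_mkseq. Qed.

(** * Back-and-forth *)

(** The second clause is density of [D] in a strong form: the approximating
    point can be chosen to contain [x] from the prescribed level on. *)
Definition rich (x : set nat) (D : set (nat -> bool)) :=
  (forall d, D d -> exists N, forall n, N <= n -> x n -> d n) /\
  (forall z N, exists2 d, D d &
     mkseq d N = mkseq z N /\ forall n, N <= n -> x n -> d n).

Lemma separating_level (T : eqType) (z : nat -> T) (L : seq (nat -> T)) :
  exists N, forall w, w \in L -> mkseq z N = mkseq w N -> z = w.
Proof.
elim: L => [|w L [N NP]]; first by exists 0.
have [zw|] := eqVneq z w.
  by exists N => v; rewrite inE => /orP[/eqP->//|]; exact: NP.
move=> /eqP zw; have [n zwn] : exists n, z n <> w n.
  by apply/existsNP => h; apply: zw; apply/funext.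
exists (maxn N n.+1) => v; rewrite inE => /orP[/eqP->|vL zv].
  by move=> /(mkseq_eqW (leq_maxr _ _))/mkseqS_eq[].
by apply: NP => //; exact: mkseq_eqW (leq_maxl _ _) zv.
Qed.

(** The finite matching extends to a tree automorphism [h].  It suffices to pick
    [e] in [E] that agrees with [h d] up to a level [N] beyond which [d]
    contains [x] and branches away from all matched points, and that contains
    [x] beyond [N]: below [N] everything is inherited from [h], and above [N]
    all branchings have happened while [d] and [e] are constantly true on
    [x]. *)
Lemma matching_extend x (L : seq ((nat -> bool) * (nat -> bool)))
    (d : nat -> bool) E :
    matching x [set` L] -> rich x E ->
    (exists N, forall n, N <= n -> x n -> d n) ->
  exists2 e, E e \/ (d, e) \in L & matching x [set` (d, e) :: L].
Proof.
move=> mL [_ Erich] [N dN].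
(* A point already matched does not branch away from itself. *)
have [dL|dL] := pselect (exists e, (d, e) \in L).
  have [e deL] := dL; exists e; first by right.
  suff -> : [set` (d, e) :: L] = [set` L] by [].
  apply/seteqP; split=> p /=; rewrite inE; last by move=> ->; rewrite orbT.
  by move=> /orP[/eqP->|].
have [N' N'P] := separating_level d [seq p.1 | p <- L].
pose h := twist (portrait [set` L]).
have [e Ee [eh ex]] := Erich (h d) (maxn N N').
exists e; first by left.
have key p n : p \in L -> mkseq d n = mkseq p.1 n <-> mkseq e n = mkseq p.2 n.
  move=> pL; have hp : h p.1 = p.2 by exact: (twist_portrait mL).
  have [nN|/ltnW nN] := leqP n (maxn N N').
    by rewrite (mkseq_eqW nN eh) -hp; exact: iff_sym (twist_isometry _ _ _ _).
  have neq : mkseq d (maxn N N') <> mkseq p.1 (maxn N N').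
    move=> /(mkseq_eqW (leq_maxr _ _))/(N'P _ (map_f _ pL)) dp.
    by apply: dL; exists p.2; rewrite dp -surjective_pairing.
  split=> [/(mkseq_eqW nN)//|/(mkseq_eqW nN)].
  by rewrite eh -hp => /twist_isometry.
have hfix n : x n -> h d n = d n.
  by apply: twist_fix => s; exact: portrait_fix mL.
split.
  move=> p q n /=; rewrite !inE => /orP[/eqP->|pL] /orP[/eqP->|qL] //=.
  - exact: key.
  - by have := key p n pL; split=> /esym/H/esym.
  - by case: mL => iso _; exact: iso.
move=> p n /=; rewrite inE => /orP[/eqP->/=|pL]; last by case: mL => _; exact.
move=> xn; have [nN|nN] := ltnP n (maxn N N').
  by rewrite -hfix//; have /mkseq_eqP-> := eh.
by rewrite ex// dN//; apply: leq_trans nN; exact: leq_maxl.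
Qed.

Lemma matching_swap x (R R' : set ((nat -> bool) * (nat -> bool))) :
  (forall p, R' p -> R (p.2, p.1)) -> matching x R -> matching x R'.
Proof.
move=> R'R [iso fx]; split=> [p q n|p n] /R'R Rp.
  by move=> /R'R /(iso _ _ n Rp)/= H; exact: iff_sym.
by move=> /(fx _ _ Rp)/= ->.
Qed.

(** Both directions follow from [matching_extend], because the inverse of a
    matching is a matching. *)
Lemma matching_step x D E (L : seq ((nat -> bool) * (nat -> bool)))
    (d e : nat -> bool) :
    rich x D -> rich x E -> D d -> E e ->
    matching x [set` L] -> (forall p, p \in L -> D p.1 /\ E p.2) ->
  exists L' : seq ((nat -> bool) * (nat -> bool)),
    [/\ matching x [set` L'], forall p, p \in L' -> D p.1 /\ E p.2,
        {subset L <= L'}, exists e', (d, e') \in L' & exists d', (d', e) \in L'].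
Proof.
move=> rD rE Dd Ee mL LDE.
have [e' e'P mL1] := matching_extend mL rE (rD.1 _ Dd).
have Ee' : E e' by case: e'P => // /LDE[].
set L1 := (d, e') :: L in mL1.
have L1DE p : p \in L1 -> D p.1 /\ E p.2.
  by rewrite inE => /orP[/eqP->|/LDE].
pose sw (p : (nat -> bool) * (nat -> bool)) := (p.2, p.1).
have swK : involutive sw by case.
have mem_sw s p : (p \in map sw s) = (sw p \in s).
  by rewrite -{1}(swK p) mem_map//; exact: inv_inj.
have [|d' d'P mL2] :=
  @matching_extend x (map sw L1) e D _ rD (rE.1 _ Ee).
  by apply: matching_swap mL1 => p; rewrite /mkset mem_sw.
have Dd' : D d' by case: d'P => //; rewrite mem_sw => /L1DE[].
exists ((d', e) :: L1); split.
- apply: matching_swap mL2 => p; rewrite /mkset !(inE, mem_sw).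
  by case: p => p1 p2; rewrite -!pair_eqE /pair_eq /= [(p2 == _) && _]andbC.
- by move=> p; rewrite inE => /orP[/eqP->|/L1DE].
- by move=> p pL; rewrite !inE pL !orbT.
- by exists e'; rewrite !inE eqxx orbT.
- by exists d'; rewrite inE eqxx.
Qed.

(** Back-and-forth along enumerations of [D] and [E].  The union of the finite
    matchings is again a matching, and its portrait is the automorphism. *)
Lemma rich_homogeneous (x : set nat) (D E : set (nat -> bool)) :
    countable D -> countable E -> rich x D -> rich x E ->
  exists a, (forall s, x (size s) -> a s = false) /\ twist a @` D = E.
Proof.
move=> cD cE rD rE.
have enum F : countable F -> rich x F -> exists2 f : nat -> nat -> bool,
    forall n, F (f n) & forall z, F z -> exists n, f n = z.
  move=> cF [_ /(_ (fun=> true) 0)[z0 Fz0 _]].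
  have /pfcard_geP [F0|[f]] : (F #<= [set: nat])%card.
  - by [].
  - by rewrite F0 in Fz0.
  by exists f => [n|z /'surj_f[n _ <-]]; [exact: 'funS_f | exists n].
have [dn Ddn Dsurj] := enum _ cD rD; have [en Een Esurj] := enum _ cE rE.
pose ok (L : seq ((nat -> bool) * (nat -> bool))) :=
  matching x [set` L] /\ forall p, p \in L -> D p.1 /\ E p.2.
have /choice[step stepP] : forall nL, exists L', ok nL.2 ->
    [/\ ok L', {subset nL.2 <= L'}, exists e, (dn nL.1, e) \in L'
      & exists d, (d, en nL.1) \in L'].
  move=> [n L] /=; have [[mL LDE]|nok] := pselect (ok L); last by exists L.
  by have [L' []] := matching_step rD rE (Ddn n) (Een n) mL LDE; exists L'.
pose L := fix L n := if n is m.+1 then step (m, L m) else [::].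
have okL n : ok (L n).
  by elim: n => [|n /(stepP (n, _))[]//]; split=> //; split.
have mono m n p : m <= n -> p \in L m -> p \in L n.
  move=> /subnK <-; elim: (n - m) => [//|k IHk] /IHk.
  by have [_ + _ _] := stepP (k + m, L (k + m)) (okL _); exact.
pose R p := exists n, p \in L n.
have mR : matching x R.
  split=> [p q k [m pm] [n qn]|p k [n pn]]; last by have [[_ fx] _] := okL n; exact: fx.
  have [[iso _] _] := okL (maxn m n); apply: iso.
    exact: mono (leq_maxl _ _) pm.
  exact: mono (leq_maxr _ _) qn.
exists (portrait R); split=> [s|]; first exact: portrait_fix mR.
apply/seteqP; split=> [_ [d /Dsurj[n <-] <-]|e /Esurj[n <-]].
  have [_ _ [e deL] _] := stepP (n, L n) (okL n).
  have Rde : R (dn n, e) by exists n.+1.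
  by rewrite (twist_portrait mR Rde)/=; have [_ /(_ _ deL)[]] := okL n.+1.
have [_ _ _ [d deL]] := stepP (n, L n) (okL n).
have Rde : R (d, en n) by exists n.+1.
exists d; last exact: (twist_portrait mR Rde).
by have [_ /(_ _ deL)[]] := okL n.+1.
Qed.

(** * Gaps in members of a P-point *)

(** A level of the binary tree is finite. *)
Lemma level_bound (N : seq bool -> nat) n :
  exists m, forall s, size s = n -> N s <= m.
Proof.
elim: n N => [|n IHn] N; first by exists (N [::]) => s /size0nil->.
have [m1 m1P] := IHn (N \o cons true); have [m2 m2P] := IHn (N \o cons false).
exists (maxn m1 m2) => -[//|[] s] [/[dup] /m1P ? /m2P ?].
  exact: leq_trans (leq_maxl _ _).
exact: leq_trans (leq_maxr _ _).
Qed.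

Lemma level_uniform (y : set nat) (D : set (nat -> bool)) n :
    (forall d, D d -> exists N, forall k, N <= k -> y k -> d k) ->
    (forall z N, exists2 d, D d & mkseq d N = mkseq z N) ->
  exists m, forall z, exists2 d, D d &
    mkseq d n = mkseq z n /\ forall k, m <= k -> y k -> d k.
Proof.
move=> Dy Ddense.
have /choice[N NP] s : exists N, exists2 d, D d &
    mkseq d (size s) = s /\ forall k, N <= k -> y k -> d k.
  have [d Dd ds] := Ddense (nth false s) (size s).
  by have [N NP] := Dy d Dd; exists N, d => //; rewrite ds mkseq_nth.
have [m mP] := level_bound N n; exists m => z.
have [d Dd []] := NP (mkseq z n); rewrite size_mkseq => dz dN.
exists d => //; split=> // k mk; apply: dN; apply: leq_trans mk.
by apply: mP; rewrite size_mkseq.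
Qed.

(** Given a word of length [n], prolong it by ones up to a gap [b j <= i < b j.+1]
    of [x] and take the point of [D] for the prolonged word: it contains [x]
    before the gap by choice of the word, within the gap vacuously, and after
    the gap because it contains [y] from [b j.+1] on. *)
Lemma rich_of_gaps (x y : set nat) (D : set (nat -> bool)) (b : nat -> nat) :
    x `<=` y ->
    (forall d, D d -> exists N, forall k, N <= k -> y k -> d k) ->
    (forall j z, exists2 d, D d &
       mkseq d (b j) = mkseq z (b j) /\ forall k, b j.+1 <= k -> y k -> d k) ->
    (forall n, exists2 j, n <= b j & forall i, b j <= i < b j.+1 -> ~ x i) ->
  rich x D.
Proof.
move=> xy Dy Db gap; split=> [d /Dy[N NP]|z n].
  by exists N => k Nk /xy; exact: NP.
have [j nj jgap] := gap n.
have [d Dd [dz dy]] := Db j (fun k => if k < n then z k else true).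
move/mkseq_eqP: dz => dz.
exists d => //; split=> [|k nk xk].
  by apply/mkseq_eqP => i ltin; rewrite dz ?ltin//; exact: leq_trans nj.
have [kj|jk] := ltnP k (b j); first by rewrite dz// ltnNge nk.
have [kj|] := ltnP k (b j.+1); last by move=> /dy; apply; exact: xy.
by case: (jgap k) => //; rewrite jk.
Qed.

(** Take a pseudointersection [y] in [U] of all points of [D] and [E], and cut
    [nat] into intervals such that, for every word of length [b j], some point
    above it contains [y] from [b j.+1] on.  As [U] is an ultrafilter, it
    contains the union of the even intervals or its complement; intersecting
    [y] with that set leaves infinitely many gaps. *)
Lemma P_point_rich (U : set_system nat) (D E : set (nat -> bool)) :
    P_point U -> countable D -> countable E ->
    (forall d, D d -> U [set n | d n]) -> (forall d, E d -> U [set n | d n]) ->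
    (forall z N, exists2 d, D d & mkseq d N = mkseq z N) ->
    (forall z N, exists2 d, E d & mkseq d N = mkseq z N) ->
  exists x, [/\ U x, rich x D & rich x E].
Proof.
move=> [UU _ Upseudo] cD cE DU EU Ddense Edense.
pose sets (F : set (nat -> bool)) := (fun d : nat -> bool => [set n | d n]) @` F.
have [y Uy ypseudo] : exists2 y, U y & pseudointersection (sets D `|` sets E) y.
  apply: Upseudo; last by move=> _ [] [d ? <-]; [exact: DU | exact: EU].
  have cF F : countable F -> countable (sets F).
    by move=> cF; exact: sub_countable (card_image_le _ _) cF.
  rewrite -bigcup2E; apply: bigcup_countable => // -[|[|k]] _ //=; exact: cF.
have ev F : sets F `<=` sets D `|` sets E ->
    forall d, F d -> exists N, forall k, N <= k -> y k -> d k.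
  move=> FDE d Fd; have /FDE/ypseudo : sets F [set n | d n] by exists d.
  rewrite /almost_subset => /finite_seqP[s sE].
  exists (\max_(i <- s) i).+1 => k sk yk; apply/negPn/negP => ndk.
  have : (y `\` [set n | d n]) k by split=> //; exact/negP.
  rewrite sE /= => ks; move: sk; rewrite ltnNge.
  by rewrite leq_bigmax_seq.
have Dy := ev D (@subsetUl _ _ _); have Ey := ev E (@subsetUr _ _ _).
have /choice[phi phiP] n : exists m, n < m /\ forall z,
    (exists2 d, D d & mkseq d n = mkseq z n /\ forall k, m <= k -> y k -> d k) /\
    (exists2 d, E d & mkseq d n = mkseq z n /\ forall k, m <= k -> y k -> d k).
  have [mD mDP] := level_uniform n Dy Ddense.
  have [mE mEP] := level_uniform n Ey Edense.
  exists (maxn n.+1 (maxn mD mE)); split; first by rewrite leq_maxl.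
  move=> z; have [d Dd [dz dk]] := mDP z; have [e Ee [ez ek]] := mEP z.
  split; [exists d => //; split=> // k | exists e => //; split=> // k].
    by rewrite !geq_max => /and3P[_ + _]; exact: dk.
  by rewrite !geq_max => /and3P[_ _ +]; exact: ek.
pose b k := iter k phi 0.
have bS k : b k < b k.+1 by have [] := phiP (b k).
have ble m n : m <= n -> b m <= b n.
  exact: (homo_leq (fun _ => leqnn _) leq_trans (fun k => ltnW (bS k))).
have blt m n i : b m <= i -> i < b n -> m < n.
  by move=> mi ib; rewrite ltnNge; apply/negP => /ble/(leq_trans ib); rewrite ltnNge mi.
have leb n : n <= b n.
  by elim: n => // n /leq_ltn_trans; apply.
pose A := [set i | exists k, b k.*2 <= i < b k.*2.+1].
have concl x : x `<=` y -> U x ->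
    (forall n, exists2 j, n <= b j & forall i, b j <= i < b j.+1 -> ~ x i) ->
  exists x, [/\ U x, rich x D & rich x E].
  move=> xy Ux gap; exists x; split=> //.
    by apply: rich_of_gaps xy Dy _ gap => j z; have [_ /(_ z)[]] := phiP (b j).
  by apply: rich_of_gaps xy Ey _ gap => j z; have [_ /(_ z)[]] := phiP (b j).
have [UA|UA] := in_ultra_setVsetC A UU.
  apply: (concl (y `&` A)); [exact: subIsetl | exact: filterI | move=> n].
  exists n.*2.+1; first by apply: leq_trans (leb _); rewrite -addnn -addSn leq_addl.
  move=> i /andP[ni iS] [_ [k /andP[ki ik]]].
  have := blt _ _ _ ni ik; rewrite ltnS ltn_double => nk.
  by have := blt _ _ _ ki iS; rewrite -doubleS ltn_double ltnS leqNgt nk.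
apply: (concl (y `&` ~` A)); [exact: subIsetl | exact: filterI | move=> n].
exists n.*2; first by apply: leq_trans (leb _); rewrite -addnn leq_addl.
by move=> i iS [_]; apply; exists n.
Qed.

(** * Ultrafilters as subspaces of the Cantor space *)

Lemma ultrafilter_cofinal (U : set_system nat) :
    UltraFilter U -> (forall n, U <> principal_filter n) ->
  forall N, U [set k | N <= k].
Proof.
move=> UU Unp; elim=> [|N IHN]; first by apply: filterS filterT => k _ /=.
have [UN|UN] := in_ultra_setVsetC [set N] UU.
  case: (Unp N); apply/seteqP; split=> A; rewrite principal_filterP.
    by move=> UA; have [_ [/= -> //]] := filter_ex (filterI UN UA).
  by move=> AN; apply: filterS UN => _ ->.
apply: filterS (filterI IHN UN) => k /= [Nk /eqP kN].
by rewrite ltn_neqAle eq_sym kN.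
Qed.

Lemma char_funP (U : set_system nat) (z : nat -> bool) :
  (char_fun @` U) z <-> U [set n | z n].
Proof.
split=> [[A UA <-]|Uz].
  by rewrite (_ : mkset _ = A)//; apply/seteqP; split=> n; rewrite /char_fun /= inE.
exists [set n | z n] => //; apply/funext => n; rewrite /char_fun.
by apply/idP/idP; rewrite inE.
Qed.

Lemma nbhs_cylinder (z : cantor_space) n :
  nbhs z [set w : cantor_space | mkseq w n = mkseq z n].
Proof.
elim: n => [|n IHn]; first by apply: filterS filterT.
have zn : nbhs z [set w : cantor_space | w n = z n].
  have /= := @proj_continuous nat (fun=> bool) n z [set z n].
  by apply; rewrite /= nbhs_principalE; exact/principal_filterP.
by apply: filterS (filterI IHn zn) => w /= ?; exact/mkseqS_eq.
Qed.

Lemma prefix_continuous (h : cantor_space -> cantor_space) :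
    (forall z w n, mkseq z n = mkseq w n -> mkseq (h z) n = mkseq (h w) n) ->
  continuous h.
Proof.
move=> hP z; apply/cvg_sup => n W [_ [[V oV <-] /= Vhz VW]].
apply: filterS (nbhs_cylinder z n.+1) => w /= /hP/mkseqS_eq[_ hwz].
by apply: VW; rewrite /= [X in V X]hwz.
Qed.

Lemma subspace_homeomorphism (S : set cantor_space)
    (h g : cantor_space -> cantor_space) :
    continuous h -> continuous g -> cancel h g -> cancel g h ->
    (forall z, S z -> S (h z)) -> (forall z, S z -> S (g z)) ->
  exists2 f : set_type S -> set_type S,
    homeomorphism f & forall u, val (f u) = h (val u).
Proof.
have restrict k : continuous k -> (forall z, S z -> S (k z)) ->
    exists2 f : set_type S -> set_type S, continuous f &
      forall u, val (f u) = k (val u).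
  move=> ck Sk; exists (fun u => exist _ (k (val u)) (mem_set (Sk _ (set_valP u)))) => //.
  apply: (@continuous_comp_initial _ _ _ set_val) => u.
  exact: continuous_comp (@initial_continuous _ _ _ u) (ck _).
move=> ch cg hK gK /(restrict _ ch)[f cf fE] /(restrict _ cg)[f' cf' f'E].
exists f => //; split=> //; exists f'; split=> // u; apply: val_inj.
  by rewrite f'E fE hK.
by rewrite fE f'E gK.
Qed.

(** A non-principal ultrafilter contains all cofinite sets, hence is dense in the
    Cantor space; so density within it is density in the whole space. *)
Lemma dense_prefix (U : set_system nat) (D : set (set_type (char_fun @` U))) :
    UltraFilter U -> (forall n, U <> principal_filter n) -> dense D ->
  forall z N, exists2 d, (val @` D) d & mkseq d N = mkseq z N.
Proof.
move=> UU Unp Ddense z N.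
pose w : cantor_space := fun k => if k < N then z k else true.
have Sw : (char_fun @` U) w.
  apply/char_funP; apply: filterS (ultrafilter_cofinal UU Unp N) => k /= Nk.
  by rewrite /w ltnNge Nk.
pose u : set_type (char_fun @` U) := exist _ w (mem_set Sw).
have nu : nbhs u (val @^-1` [set v : cantor_space | mkseq v N = mkseq w N]).
  exact: (@initial_continuous _ _ _ u _ (nbhs_cylinder w N)).
move: nu; rewrite nbhsE => -[O [oO Ou] OC].
have [v [Ov Dv]] := Ddense O (ex_intro _ u Ou) oO.
exists (val v); first by exists v.
have -> : mkseq (val v) N = mkseq w N := OC _ Ov.
by apply/mkseq_eqP => i iN; rewrite /w iN.
Qed.

(** The automorphism matching [D] with [E] changes points only off a set [x] in
    [U], so a point and its image meet [x] in the same set and lie in [U]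
    together. *)
Theorem P_point_countable_dense_homogeneous (U : set_system nat) :
  P_point U -> countable_dense_homogeneous (set_type (char_fun @` U)).
Proof.
move=> PU D E cD dD cE dE; have [UU Unp _] := PU.
have cval (F : set (set_type (char_fun @` U))) : countable F -> countable (val @` F).
  by move=> cF; exact: sub_countable (card_image_le _ _) cF.
have Uval (F : set (set_type (char_fun @` U))) d : (val @` F) d -> U [set n | d n].
  by move=> [u _ <-]; apply/char_funP; exact: set_valP.
have [x [Ux rD rE]] := P_point_rich PU (cval _ cD) (cval _ cE) (@Uval D) (@Uval E)
  (dense_prefix UU Unp dD) (dense_prefix UU Unp dE).
have [a [ax aDE]] := rich_homogeneous (cval _ cD) (cval _ cE) rD rE.
have Utwist z : (char_fun @` U) z -> (char_fun @` U) (twist a z).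
  move=> /char_funP Uz; apply/char_funP; apply: filterS (filterI Ux Uz) => n /= [xn].
  by rewrite (twist_fix _ ax xn).
have Uuntwist z : (char_fun @` U) z -> (char_fun @` U) (untwist a z).
  move=> /char_funP Uz; apply/char_funP; apply: filterS (filterI Ux Uz) => n /= [xn].
  by rewrite -[in z n](untwistK a z) (twist_fix _ ax xn).
have [f hf fE] := @subspace_homeomorphism _ (twist a) (untwist a)
  (prefix_continuous (fun z w n => (twist_isometry a z w n).2))
  (prefix_continuous (fun z w n => (untwist_isometry a z w n).2))
  (twistK a) (untwistK a) Utwist Uuntwist.
exists f => //; apply/seteqP; split=> [_ [u Du <-]|v Ev].
  have : (twist a @` (val @` D)) (val (f u)) by rewrite fE; exists (val u) => //; exists u.
  by rewrite aDE => -[v Ev /val_inj <-].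
have : (val @` E) (val v) by exists v.
by rewrite -aDE => -[_ [u Du <-]] uv; exists u => //; apply: val_inj; rewrite fE.
Qed.

Theorem theorem44 :
  MA_countable ->
  exists U : set_system nat,
    P_point U /\ countable_dense_homogeneous (set_type (char_fun @` U)).
Proof.
move=> /P_point_exists[U PU]; exists U; split=> //.
exact: P_point_countable_dense_homogeneous.
Qed.
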